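(* Let $\mathcal{A}$, the generators $h_{\boldsymbol{j}}$, the graph $G_M$, the charges $Q_M^{(k)}$ and $H_M$ be as in the context, and assume the extra relation $A_{2m-1}C_{2m+2}=C_{2m}A_{2m+3}$ holds for all integers $m$ with $2\le m\le \lfloor M/2\rfloor-2$. Then $[H_M,Q_M^{(k)}]=0$ for every integer $k\ge 0$.
   Context: Extended FFD setting. Fix an integer $M\ge 1$ and complex numbers $b_1,\dots,b_M$ and $\bar b_{2m+1}$ for $0\le m\le\lfloor M/2\rfloor$. Let $\mathcal{A}$ be a unital associative complex algebra containing elements $h_1,\dots,h_M$ and $\bar h_{1},\bar h_3,\dots,\bar h_{2\lfloor M/2\rfloor+1}$ (the ''generators''; write $h_{\overline{2m+1}}:=\bar h_{2m+1}$), with $h_j^2=b_j^2\,\mathbb{1}$ and $\bar h_{2m+1}^2=\bar b_{2m+1}^2\,\mathbb{1}$. Define the frustration graph $G_M=(V_M,E_M)$ whose vertices are the generators and whose edges are: $h_i\sim h_j$ iff $|i-j|\in\{1,2\}$; $\bar h_{2m-1}\sim h_j$ iff $j\in\{2m-7,2m-5,2m-3,2m-1,2m-2,2m\}$; $\bar h_{2m-1}\sim\bar h_{2m'-1}$ iff $|m-m'|=1$. Assume adjacent generators anticommute and distinct non-adjacent generators commute. Any symbol $h_j$ or $\bar h_j$ whose index lies outside the ranges above denotes $0$. Define $A_{2m-1}:=h_{2m}h_{2m-3}+h_{2m-2}\bar h_{2m+1}$ and $C_{2m}:=h_{2m-3}\bar h_{2m+3}$. An independent set is a set of vertices of $G_M$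 no two of which are adjacent; for an independent set $S$, $h_S:=\prod_{v\in S}h_v$ (the factors commute, so the order is irrelevant), $h_\emptyset=\mathbb{1}$. The charges are $Q_M^{(k)}:=\sum_{S\text{ independent},\,|S|=k}h_S$ ($Q_M^{(0)}=\mathbb{1}$), and $H_M:=Q_M^{(1)}=\sum_{j=1}^M h_j+\sum_{m=0}^{\lfloor M/2\rfloor}\bar h_{2m+1}$. *)

(* Defs.v *)
From HB Require Import structures.
From mathcomp Require Import all_boot all_order all_algebra.
From mathcomp Require Import complex.
From mathcomp Require Import reals.
Set Implicit Arguments. Unset Strict Implicit. Unset Printing Implicit Defensive.
Import Order.TTheory GRing.Theory Num.Theory.

(* Vertices of the frustration graph G_M:
   inl i  (i : 'I_M)            stands for h_{i+1}            (1 <= i+1 <= M)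
   inr m  (m : 'I_(M./2).+1)    stands for \bar h_{2m+1}      (0 <= m <= floor(M/2)) *)
Definition vert (M : nat) : finType := ('I_M + 'I_(M./2).+1)%type.

(* adjacency between \bar h_n (n odd) and h_j :
   j \in {n-6, n-4, n-2, n, n-1, n+1}  (i.e. n = 2m-1, j \in {2m-7,2m-5,2m-3,2m-1,2m-2,2m}) *)
Definition bar_adj (n j : nat) : bool :=
  [|| j + 6 == n, j + 4 == n, j + 2 == n, j == n, j + 1 == n | j == n + 1].

Definition adj (M : nat) (u v : vert M) : bool :=
  match u, v with
  | inl i, inl j => let i := val i in let j := val j in
                    [|| i == j + 1, i == j + 2, j == i + 1 | j == i + 2]
  | inr m, inl j => bar_adj (2 * val m + 1) (val j + 1)
  | inl j, inr m => bar_adj (2 * val m + 1) (val j + 1)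
  | inr m, inr m' => (val m == val m' + 1) || (val m' == val m + 1)
  end.

Definition independent (M : nat) (S : {set vert M}) : bool :=
  [forall u in S, forall v in S, ~~ adj u v].

Local Open Scope ring_scope.

Section Charges.
Variables (C : nzRingType) (A : algType C) (M : nat) (h : vert M -> A).

(* h_S := product over S (factors commute under the hypotheses) *)
Definition hS (S : {set vert M}) : A := \prod_(v in S) h v.

Definition Q (k : nat) : A :=
  \sum_(S : {set vert M} | independent S && (#|S| == k)) hS S.

Definition H : A := \sum_(v : vert M) h v.

(* h_j for an integer index j, 0 outside 1 <= j <= M *)
Definition hgen (j : int) : A :=
  match j with
  | Posz n.+1 => match (insub n : option 'I_M) with Some i => h (inl i) | None => 0 end
  | _ => 0
  end.

(* \bar h_j for an integer index j, 0 unless j = 2m+1 with 0 <= m <= floor(M/2) *)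
Definition hbar (j : int) : A :=
  match j with
  | Posz n => if odd n then
                match (insub n./2 : option 'I_(M./2).+1) with
                | Some m => h (inr m) | None => 0 end
              else 0
  | _ => 0
  end.

(* Aop m = A_{2m-1} := h_{2m} h_{2m-3} + h_{2m-2} \bar h_{2m+1} *)
Definition Aop (m : int) : A :=
  hgen (2 * m) * hgen (2 * m - 3) + hgen (2 * m - 2) * hbar (2 * m + 1).

(* Cop m = C_{2m} := h_{2m-3} \bar h_{2m+3} *)
Definition Cop (m : int) : A := hgen (2 * m - 3) * hbar (2 * m + 3).

End Charges.

(* Main.v *)
(* Moving h_v past h_S costs (-1)^c with c = #|S :&: N(v)|, so only the pairs
   (v, S) with c odd contribute to the commutator, each with 2 h_v h_S.  Group
   them by the induced star (v, K), K = S :&: N(v).  When #|K| = 1, exchanging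
   v with its neighbour in S reverses the sign, so these terms cancel.  In G_M
   the remaining stars are claws, and they come in quadruples sharing one closed
   neighbourhood: two centred at h_{2m-1}, whose monomials add up to
   A_{2m-1} C_{2m+2}, and two centred at \bar h_{2m+3}, whose monomials add up to
   - C_{2m} A_{2m+3}.  A quadruple lies inside G_M exactly when
   2 <= m <= floor(M/2) - 2, the range of the extra relation. *)
Require Import Defs.
From HB Require Import structures.
From mathcomp Require Import all_boot all_order all_algebra.
From mathcomp Require Import complex zify.
From mathcomp Require Import reals.
Set Implicit Arguments.
Unset Strict Implicit.
Unset Printing Implicit Defensive.
Import Order.TTheory GRing.Theory Num.Theory.
Local Open Scope ring_scope.

(** * Commutator of the charges on an arbitrary graph, expanded over induced stars *)

Section OddStars.
Variables (V : finType) (e : rel V) (A : nzRingType) (h : V -> A).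
Hypothesis e_sym : symmetric e.
Hypothesis e_irr : irreflexive e.
Hypothesis h_anti : forall u v, e u v -> h u * h v = - (h v * h u).
Hypothesis h_comm : forall u v, u != v -> ~~ e u v -> h u * h v = h v * h u.

Definition stable (S : {set V}) := [forall u in S, forall v in S, ~~ e u v].
Definition detached (L T : {set V}) :=
  [forall u in L, forall w in T, (u != w) && ~~ e u w].
Definition nbhd (v : V) := [set u | e v u].
Definition star (v : V) (K : {set V}) := stable K && (K \subset nbhd v).
Definition hprod (S : {set V}) : A := \prod_(v in S) h v.
(** The size offset [n] is separate from [L] because, in a star, the centre lies in [L] but is a
    factor of [H], not an element of the independent set; only the leaves count towards [k]. *)
Definition rest_sum (L : {set V}) (n k : nat) : A :=
  \sum_(T | [&& stable T, (n + #|T|)%N == k & detached L T]) hprod T.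
(* Sum of h_v h_S over the independent S of size k with S :&: N(v) = K. *)
Definition star_term (k : nat) (v : V) (K : {set V}) : A :=
  h v * hprod K * rest_sum (v |: K) #|K| k.

Lemma stableP (S : {set V}) :
  reflect (forall u v, u \in S -> v \in S -> ~~ e u v) (stable S).
Proof.
apply: (iffP forall_inP) => [sS u v uS vS|sS u uS].
  by have /forall_inP := sS u uS; apply.
by apply/forall_inP => v vS; apply: sS.
Qed.

Lemma detachedP (L T : {set V}) :
  reflect (forall u w, u \in L -> w \in T -> u != w /\ ~~ e u w) (detached L T).
Proof.
apply: (iffP forall_inP) => [d u w uL wT|d u uL].
  by have /forall_inP/(_ w wT)/andP := d u uL.
by apply/forall_inP => w wT; apply/andP; apply: d.
Qed.

Lemma h_sign u v : h u * h v = (-1) ^+ e u v * (h v * h u).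
Proof.
case: (boolP (e u v)) => [euv|neuv]; rewrite ?expr1 ?expr0 ?mul1r ?mulN1r.
  exact: h_anti.
by case: (eqVneq u v) => [->//|nuv]; apply: h_comm.
Qed.

Lemma prod_h_sign (r : seq V) (P : pred V) v :
  (\prod_(u <- r | P u) h u) * h v =
  (-1) ^+ (\sum_(u <- r | P u) e u v)%N * (h v * \prod_(u <- r | P u) h u).
Proof.
elim: r => [|x r IHr]; first by rewrite !big_nil expr0 !mul1r mulr1.
rewrite !big_cons; case: (P x) => //.
rewrite -mulrA IHr addnC exprD (mulrA (h x)) commr_sign -!mulrA; congr (_ * _).
by rewrite mulrA h_sign -!mulrA.
Qed.

Lemma hprod_sign (S : {set V}) v :
  hprod S * h v = (-1) ^+ #|S :&: nbhd v| * (h v * hprod S).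
Proof.
rewrite /hprod prod_h_sign; congr (_ ^+ _ * _).
rewrite -sum1dep_card big_mkcondr /=; apply: eq_bigr => u _.
by rewrite inE e_sym; case: (e v u).
Qed.

Lemma prod_hU (r : seq V) (P1 P2 : pred V) :
  (forall u v, P1 u -> P2 v -> u != v /\ ~~ e u v) ->
  \prod_(u <- r | P1 u || P2 u) h u =
  (\prod_(u <- r | P1 u) h u) * \prod_(u <- r | P2 u) h u.
Proof.
move=> dis; elim: r => [|x r IHr]; first by rewrite !big_nil mulr1.
rewrite !big_cons IHr; case P1x: (P1 x); case P2x: (P2 x) => //=.
- by have [/eqP] := dis x x P1x P2x.
- by rewrite mulrA.
(* Here [x] belongs to the second product and must move past the whole first product. *)
rewrite !mulrA; congr (_ * _); apply: commr_prod => u P1u.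
have [nux neux] := dis u x P1u P2x.
by rewrite /GRing.comm h_comm // 1?eq_sym // e_sym.
Qed.

Lemma hprodU (K T : {set V}) : detached K T -> hprod (K :|: T) = hprod K * hprod T.
Proof.
move=> /detachedP dKT; rewrite /hprod -prod_hU //.
by apply: eq_bigl => u; rewrite inE.
Qed.

Lemma hprod1 u : hprod [set u] = h u.
Proof. by rewrite /hprod big_set1. Qed.

Definition claw (v a b c : V) : bool :=
  [&& [&& e v a, e v b & e v c], [&& a != b, a != c & b != c]
    & [&& ~~ e a b, ~~ e a c & ~~ e b c]].

Lemma claw_star v a b c : claw v a b c -> star v [set a; b; c].
Proof.
case/and3P=> /and3P[va vb vc] _ /and3P[nab nac nbc]; apply/andP; split.
  have nba : ~~ e b a by rewrite e_sym.
  have nca : ~~ e c a by rewrite e_sym.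
  have ncb : ~~ e c b by rewrite e_sym.
  apply/stableP => u w; rewrite !inE.
  by case/orP=> [/orP[]|] /eqP-> /orP[/orP[]|] /eqP->; rewrite // e_irr.
by apply/subsetP => u; rewrite !inE => /orP[/orP[]|] /eqP->.
Qed.

Lemma claw_card v a b c : claw v a b c -> #|[set a; b; c]| = 3.
Proof.
case/and3P=> _ /and3P[ab ac bc] _.
rewrite setUC cardsU1 !inE negb_or ![c == _]eq_sym ac bc.
by rewrite cardsU1 !inE ab cards1.
Qed.

Lemma claw_hprod v a b c : claw v a b c -> hprod [set a; b; c] = h a * h b * h c.
Proof.
case/and3P=> _ /and3P[ab ac bc] /and3P[nab nac nbc].
rewrite !hprodU ?hprod1 //; apply/detachedP => u w; rewrite !inE.
  by move=> /eqP-> /eqP->.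
by case/orP=> /eqP-> /eqP->.
Qed.

(** The map sending [T] to [K :|: T] is a bijection onto the fibre: once [K] is removed, what is
    left of [S] avoids the star and all its neighbours. *)
Lemma star_fiber (k : nat) v (K : {set V}) : star v K -> odd #|K| ->
  \sum_(S | (stable S && (#|S| == k)) && (S :&: nbhd v == K)) h v * hprod S =
  star_term k v K.
Proof.
move=> /andP[sK KN] oK; rewrite /star_term /rest_sum big_distrr /=.
rewrite (reindex_onto (fun T => K :|: T) (fun S => S :\: K)) /=; last first.
  move=> S /andP[_ /eqP <-]; apply/setP => u; rewrite !inE.
  by case: (u \in S); case: (e v u).
(* Oddness makes [K] nonempty. Its element [u0] is adjacent to [v] but to nothing in [S], which
   keeps [v] itself out of [T]. *)
have [u0 u0K] : exists u, u \in K by apply/card_gt0P; case: #|K| oK.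
apply: eq_big => [T|T].
  apply/idP/idP => [/andP[/andP[/andP[/stableP sKT /eqP cKT] /eqP NKT] /eqP KT]|].
    have dKT u : u \in T -> u \notin K by rewrite -KT inE => /andP[].
    have NT w : w \in T -> ~~ e v w.
      move=> wT; apply: contra (dKT w wT) => evw.
      by rewrite -NKT !inE wT orbT.
    apply/and3P; split.
    - by apply/stableP => u w uT wT; apply: sKT; rewrite inE (uT, wT) orbT.
    - rewrite -cKT cardsU; suff -> : K :&: T = set0 by rewrite cards0 subn0.
      apply/setP => u; rewrite !inE; case uT: (u \in T); last by rewrite andbF.
      by rewrite (negbTE (dKT u uT)).
    - apply/detachedP => u w; rewrite in_setU1 => /orP[/eqP-> wT|uK wT].
        split; last exact: NT.
        apply: contraTneq (subsetP KN _ u0K) => ->; rewrite inE.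
        by apply: sKT; rewrite inE ?u0K ?wT ?orbT.
      split; last by apply: sKT; rewrite inE ?uK ?wT ?orbT.
      by apply: contraNneq (dKT w wT) => <-.
  move=> /and3P[/stableP sT /eqP cT /detachedP d].
  have dKT u : u \in T -> u \notin K.
    by move=> uT; apply/negP => uK; have [|/eqP] := d u u _ uT; rewrite // inE uK orbT.
  have KT0 : K :&: T = set0.
    apply/setP => u; rewrite !inE; case uT: (u \in T); last by rewrite andbF.
    by rewrite (negbTE (dKT u uT)).
  have KTe u w : u \in K -> w \in T -> ~~ e u w.
    by move=> uK wT; have [] := d u w _ wT; rewrite // inE uK orbT.
  have vTe w : w \in T -> ~~ e v w.
    by move=> wT; have [] := d v w _ wT; rewrite // setU11.
  apply/andP; split; last first.
    apply/eqP/setP => u; rewrite !inE; case uT: (u \in T); last by case: (u \in K).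
    by rewrite (negbTE (dKT u uT)).
  rewrite cardsU KT0 cards0 subn0 cT eqxx andbT; apply/andP; split.
    apply/stableP => u w; rewrite !inE => /orP[uK|uT] /orP[wK|wT].
    - by move/stableP: sK; apply.
    - exact: KTe.
    - by rewrite e_sym; apply: KTe.
    - exact: sT.
  apply/eqP/setP => u; rewrite !inE; case uK: (u \in K) => /=.
    by have := subsetP KN u uK; rewrite inE.
  by case uT: (u \in T) => //=; rewrite (negbTE (vTe u uT)).
move=> /andP[/andP[/andP[/stableP sKT _] _] /eqP KT].
rewrite hprodU ?mulrA //; apply/detachedP => u w uK wT; split.
  by apply: contraTneq uK => ->; move: wT; rewrite -KT inE => /andP[].
by apply: sKT; rewrite inE ?uK ?wT ?orbT.
Qed.

Lemma commutator_stars (k : nat) :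
  (\sum_v h v) * (\sum_(S | stable S && (#|S| == k)) hprod S) -
  (\sum_(S | stable S && (#|S| == k)) hprod S) * (\sum_v h v) =
  (\sum_v \sum_(K | star v K && odd #|K|) star_term k v K) *+ 2.
Proof.
rewrite mulr_suml mulr_sumr -sumrB -sumrMnl; apply: eq_bigr => v _.
rewrite mulr_sumr mulr_suml -sumrB -sumrMnl.
pose o (S : {set V}) := odd #|S :&: nbhd v|.
rewrite (bigID o) /= [X in _ + X]big1 ?addr0; last first.
  move=> S /andP[_ oS]; rewrite hprod_sign -signr_odd.
  by move: oS; rewrite /o => /negbTE->; rewrite expr0 mul1r subrr.
rewrite (partition_big (fun S => S :&: nbhd v) (fun K => star v K && odd #|K|)) /=.
  apply: eq_bigr => K /andP[sK oK]; rewrite -star_fiber // -sumrMnl.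
  apply: eq_big => [S|S].
    by case: (_ :&: _ =P K) => [SK|]; rewrite ?andbF // /o SK oK !andbT.
  move=> /andP[/andP[_ oS] _]; rewrite hprod_sign -signr_odd.
  by move: oS; rewrite /o => ->; rewrite expr1 mulN1r opprK mulr2n.
move=> S /andP[/andP[/stableP sS _] oS]; rewrite -/(o S) oS andbT.
apply/andP; split; last exact: subsetIr.
by apply/stableP => u w /setIP[uS _] /setIP[wS _]; apply: sS.
Qed.

Lemma edge_terms_cancel (k : nat) :
  (\sum_v \sum_(u | e v u) star_term k v [set u]) *+ 2 = 0.
Proof.
rewrite mulr2n; apply/eqP; rewrite addr_eq0; apply/eqP.
rewrite [in RHS](exchange_big_dep predT) //= -sumrN; apply: eq_bigr => v _.
rewrite -sumrN; apply: eq_big => [u|u evu]; first by rewrite e_sym.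
by rewrite /star_term !hprod1 !cards1 setUC h_anti // !mulNr.
Qed.

Lemma commutator_claws (k : nat) :
  (\sum_v h v) * (\sum_(S | stable S && (#|S| == k)) hprod S) -
  (\sum_(S | stable S && (#|S| == k)) hprod S) * (\sum_v h v) =
  (\sum_v \sum_(K | [&& star v K, odd #|K| & (2 < #|K|)%N]) star_term k v K) *+ 2.
Proof.
rewrite commutator_stars.
under eq_bigr => v _ do rewrite (bigID (fun K : {set V} => (2 < #|K|)%N)) /=.
rewrite big_split /= mulrnDl [X in _ + X](_ : _ = 0) ?addr0.
  congr (_ *+ 2); apply: eq_bigr => v _; apply: eq_bigl => K.
  by rewrite andbA.
rewrite -[RHS](edge_terms_cancel k); congr (_ *+ 2); apply: eq_bigr => v _.
rewrite -[RHS](big_imset (star_term k v) (in2W (@set1_inj V))).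
apply: eq_bigl => K; apply/andP/imsetP => [[/andP[/andP[_ KN] oK] cK]|[u]].
  (* An odd cardinal that is at most 2 equals 1. *)
  have /cards1P[u Ku] : #|K| == 1%N by move: oK cK; case: #|K| => [|[|[|?]]].
  by exists u => //; have := subsetP KN u; rewrite Ku !inE eqxx; apply.
rewrite unfold_in => evu ->; rewrite cards1; split => //; rewrite andbT.
apply/andP; split; last by rewrite sub1set inE.
by apply/stableP => x y /set1P-> /set1P->; rewrite e_irr.
Qed.
End OddStars.

(** * Classification of the claws of the frustration graph *)

Section Claws.
Variable M : nat.

Lemma adj_sym : symmetric (@adj M).
Proof. by case=> [i|p] [j|q] //=; lia. Qed.
Lemma adj_irr : irreflexive (@adj M).
Proof. by case=> [i|p] //=; lia. Qed.

(** A linear order with every [inl] before every [inr], so that the three leaves of a claw can be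
    listed in a single way. *)
Definition vcode (u : vert M) : nat :=
  match u with inl i => i | inr p => M + p end.

Lemma vcode_inj : injective vcode.
Proof.
case=> [i|p] [j|q] /= ij.
- by congr inl; apply: val_inj.
- by have := ltn_ord i; lia.
- by have := ltn_ord j; lia.
- by congr inr; apply: val_inj; apply/eqP; rewrite -(eqn_add2l M) ij.
Qed.

Hypothesis M_gt0 : (0 < M)%N.

(* 0-based: xv i stands for h_{i+1} and yv p for \bar h_{2p+1}.  Out-of-range
   indices give junk vertices, not 0. *)
Definition xv (i : nat) : vert M := inl (insubd (Ordinal M_gt0) i).
Definition yv (p : nat) : vert M := inr (inord p).

(* With m = i + 2, the claws f = (true, _) and f = (false, _) give the two terms of
   A_{2m-1} C_{2m+2} and of C_{2m} A_{2m+3} respectively; leaves are listed in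
   increasing order for vcode. *)
Definition claw_center (i : nat) (f : bool * bool) : vert M :=
  if f.1 then xv (2 * i + 2) else yv (i + 3).
Definition claw_leaf (i : nat) (f : bool * bool) : vert M * vert M * vert M :=
  match f with
  | (true, true) => (xv (2 * i), xv (2 * i + 3), yv (i + 4))
  | (true, false) => (xv (2 * i + 1), yv (i + 2), yv (i + 4))
  | (false, true) => (xv (2 * i), xv (2 * i + 4), xv (2 * i + 7))
  | (false, false) => (xv (2 * i), xv (2 * i + 5), yv (i + 4))
  end.
Definition leaf1 i f := (claw_leaf i f).1.1.
Definition leaf2 i f := (claw_leaf i f).1.2.
Definition leaf3 i f := (claw_leaf i f).2.
Definition claw_leaves i f := [set leaf1 i f; leaf2 i f; leaf3 i f].

Lemma val_x i : (i < M)%N -> insubd (Ordinal M_gt0) i = i :> nat.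
Proof. by move=> iM; rewrite val_insubd iM. Qed.
Lemma inl_x a i : (i < M)%N -> (inl a == xv i) = (val a == i).
Proof. by move=> iM; rewrite /xv -[LHS]/(a == _) -val_eqE val_insubd iM. Qed.
Lemma inr_y a p : (p <= M./2)%N -> (inr a == yv p) = (val a == p).
Proof. by move=> pM; rewrite /yv -[LHS]/(a == _) -val_eqE /= inordK. Qed.
Lemma x_x i j : (i < M)%N -> (j < M)%N -> (xv i == xv j) = (i == j).
Proof. by move=> iM jM; rewrite inl_x //= val_x. Qed.
Lemma y_y i j : (i <= M./2)%N -> (j <= M./2)%N -> (yv i == yv j) = (i == j).
Proof. by move=> iM jM; rewrite inr_y //= inordK. Qed.
Lemma inl_y a p : (inl a == yv p) = false. Proof. by []. Qed.
Lemma inr_x a i : (inr a == xv i) = false. Proof. by []. Qed.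
Lemma x_y i p : (xv i == yv p) = false. Proof. by []. Qed.
Lemma y_x i p : (yv p == xv i) = false. Proof. by []. Qed.

Lemma claw_center_leaf i f : (i + 3 < M./2)%N ->
  claw (@adj M) (claw_center i f) (leaf1 i f) (leaf2 i f) (leaf3 i f).
Proof.
move=> iM; rewrite /claw /claw_center /leaf1 /leaf2 /leaf3.
by case: f => [[] []] /=; rewrite ?x_x ?y_y ?x_y ?y_x /= ?val_x ?inordK /bar_adj; lia.
Qed.

(* Complement of the closed neighbourhood common to the four claws of index i. *)
Definition outside (i : nat) (w : vert M) : bool :=
  match w with
  | inl a => ~~ (2 * i <= a + 2 <= 2 * i + 11)%N
  | inr p => ~~ (i <= p <= i + 5)%N
  end.

Lemma claw_outside i f w : (i + 3 < M./2)%N ->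
  [forall u in claw_center i f |: claw_leaves i f, (u != w) && ~~ adj u w] =
  outside i w.
Proof.
move=> iM.
(* Over an explicit list the quantifier computes, and only index arithmetic remains. *)
transitivity (all (fun u => (w != u) && ~~ adj u w)
  [:: claw_center i f; leaf1 i f; leaf2 i f; leaf3 i f]).
  apply/forall_inP/allP => d u uL; rewrite eq_sym; apply: d; move: uL;
  by rewrite !inE ?orbA.
rewrite /claw_center /leaf1 /leaf2 /leaf3.
case: f => [[] []] /=; case: w => w /=;
rewrite ?inl_x ?inr_y ?inr_x ?inl_y /= ?val_x ?inordK /bar_adj; lia.
Qed.

(** This excludes induced stars with more than three leaves. *)
Lemma claw_maximal i f u : (i + 3 < M./2)%N -> adj (claw_center i f) u ->
  (forall w, w \in claw_leaves i f -> ~~ adj u w) -> u \in claw_leaves i f.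
Proof.
move=> iM cu nu; have := nu (leaf1 i f); have := nu (leaf2 i f).
have := nu (leaf3 i f); rewrite !inE !eqxx /= ?orbT {nu}.
move=> /(_ isT) n3 /(_ isT) n2 /(_ isT) n1; move: cu n1 n2 n3.
rewrite /claw_center /leaf1 /leaf2 /leaf3.
case: f => [[] []] /=; case: u => u /=;
rewrite ?inl_x ?inr_y ?inr_x ?inl_y /= ?val_x ?inordK /bar_adj; lia.
Qed.

Lemma claw_center_inj i f j g : (i + 3 < M./2)%N -> (j + 3 < M./2)%N ->
  claw_center i f = claw_center j g -> claw_leaves i f = claw_leaves j g ->
  i = j /\ f = g.
Proof.
move=> iM jM /eqP cE /setP lE.
have ij : i = j.
  move: cE; rewrite /claw_center; case: f.1 {lE}; case: g.1; rewrite ?x_y ?y_x //.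
    by rewrite x_x; lia.
  by rewrite y_y; lia.
split=> //; subst j.
(* The centre determines [f.1]. Then [xv (2 * i + 3)] is a leaf of only one of the two claws with
   [f.1 = true], and [xv (2 * i + 7)] of only one of those with [f.1 = false]. *)
have := lE (leaf2 i (true, true)); have := lE (leaf3 i (false, true)).
rewrite !inE {lE}; move: cE; rewrite /claw_center /leaf1 /leaf2 /leaf3.
case: f => [[] []]; case: g => [[] []] //=;
rewrite ?x_x ?y_y ?x_y ?y_x //=; lia.
Qed.

Lemma claw_classify v a b c : claw (@adj M) v a b c ->
  (vcode a < vcode b)%N -> (vcode b < vcode c)%N ->
  exists i f, [/\ (i + 3 < M./2)%N, v = claw_center i f
    & (a, b, c) = claw_leaf i f].
Proof.
have xvE (n : nat) (j : 'I_M) : n = j :> nat -> inl j = xv n.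
  by move=> ->; congr inl; apply: val_inj; rewrite /= val_x.
have yvE (n : nat) (p : 'I_(M./2).+1) : n = p :> nat -> inr p = yv n.
  by move=> ->; congr inr; apply: val_inj; rewrite /= inordK.
(* Sorted leaves have 0, 1, 2 or 3 barred vertices at the end; with two kinds of centre this leaves
   eight cases, of which four are realised. *)
move=> cl ab bc; case: a b c ab bc cl => [a|a] [b|b] [c|c] /= ab bc;
  have := ltn_ord a; have := ltn_ord b; have := ltn_ord c; move=> cM bM aM;
  try (by exfalso; lia);
  case: v => v; have := ltn_ord v; move=> vM;
  case/and3P; rewrite /= /bar_adj => /and3P[va vb vc] _ /and3P[nab nac nbc].
- by exfalso; lia.
- have [H1 H2 H3] : [/\ 2 * v = a + 6, b = (a + 4)%N :> nat & c = (a + 7)%N :> nat]%N by split; lia.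
  (* The smallest leaf is [xv (2 * i)] or [xv (2 * i + 1)] in every claw of the list, so halving its
     index recovers [i]. *)
  exists a./2, (false, true); rewrite /claw_center /=.
  split; first lia; first by apply: yvE; lia.
  by congr (_, _, _); [apply: xvE | apply: xvE | apply: xvE]; lia.
- have [H1 H2 H3] : [/\ v = (a + 2)%N :> nat, b = (v + 1)%N :> nat & 2 * c = v + 6]%N by split; lia.
  exists a./2, (true, true); rewrite /claw_center /=.
  split; first lia; first by apply: xvE; lia.
  by congr (_, _, _); [apply: xvE | apply: xvE | apply: yvE]; lia.
- have [H1 H2 H3] : [/\ 2 * v = a + 6, b = (a + 5)%N :> nat & c = (v + 1)%N :> nat]%N by split; lia.
  exists a./2, (false, false); rewrite /claw_center /=.
  split; first lia; first by apply: yvE; lia.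
  by congr (_, _, _); [apply: xvE | apply: xvE | apply: yvE]; lia.
- have [H1 H2 H3] : [/\ v = (a + 1)%N :> nat, 2 * b = v + 2 & 2 * c = v + 6]%N by split; lia.
  exists a./2, (true, false); rewrite /claw_center /=.
  split; first lia; first by apply: xvE; lia.
  by congr (_, _, _); [apply: xvE | apply: yvE | apply: yvE]; lia.
- by exfalso; lia.
- by exfalso; lia.
- by exfalso; lia.
Qed.
End Claws.

(** * Cancellation of each quadruple of claws by the extra relation *)

Section ClawSum.
Variables (M : nat) (M_gt0 : (0 < M)%N).

Local Notation center := (claw_center M_gt0).
Local Notation leaves := (claw_leaves M_gt0).

(** Three elements of [K], sorted by [vcode], already form a listed claw with centre [v]; by
    maximality [K] contains nothing else. *)
Lemma star_classify v (K : {set vert M}) :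
  star (@adj M) v K -> (2 < #|K|)%N ->
  exists i f, [/\ (i + 3 < M./2)%N, v = center i f & K = leaves i f].
Proof.
case/andP=> /stableP sK /subsetP KN cK.
have [a [b [c [[aK bK cK'] ab bc]]]] : exists a b c : vert M,
    [/\ [/\ a \in K, b \in K & c \in K], vcode a < vcode b & vcode b < vcode c]%N.
  have [x [y [z [[xK yK zK] [xy yz zx]]]]] := card_gt2P cK.
  move: xy yz zx; rewrite -!(inj_eq (@vcode_inj M)) => xy yz zx.
  case: (ltnP (vcode x) (vcode y)) => lxy; case: (ltnP (vcode y) (vcode z)) => lyz;
    case: (ltnP (vcode z) (vcode x)) => lzx; try (by exfalso; lia);
    first [ by exists x, y, z; split=> //; lia | by exists x, z, y; split=> //; lia
          | by exists y, x, z; split=> //; lia | by exists y, z, x; split=> //; lia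
          | by exists z, x, y; split=> //; lia | by exists z, y, x; split=> //; lia].
have cl : claw (@adj M) v a b c.
  have ne (u w : vert M) : (vcode u < vcode w)%N -> u != w.
    by move=> luw; apply: contraTneq luw => ->; rewrite ltnn.
  rewrite /claw !sK // !ne ?(ltn_trans ab bc) //= !andbT.
  by have := KN a aK; have := KN b bK; have := KN c cK'; rewrite !inE => -> -> ->.
have [i [f [iM vE abcE]]] := claw_classify M_gt0 cl ab bc.
exists i, f; split=> //; apply/eqP; rewrite eqEsubset.
have lK : leaves i f \subset K.
  rewrite /claw_leaves /leaf1 /leaf2 /leaf3 -abcE /=.
  by apply/subsetP => u; rewrite !inE => /orP[/orP[]|] /eqP->.
rewrite lK andbT; apply/subsetP => u uK; apply: claw_maximal => //.
  by have := KN u uK; rewrite inE vE.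
by move=> w wl; apply: sK => //; apply: (subsetP lK).
Qed.

(** Reindexing along the injection from [(i, f)] to (centre, leaves). The truncated bound [M./2 - 3]
    gives an empty sum for small [M]. *)
Lemma claw_sum (U : nmodType) (F : vert M -> {set vert M} -> U) :
  \sum_v \sum_(K | [&& star (@adj M) v K, odd #|K| & (2 < #|K|)%N]) F v K =
  \sum_(i < M./2 - 3) \sum_s \sum_t F (center i (s, t)) (leaves i (s, t)).
Proof.
under [RHS]eq_bigr => i _ do
  rewrite (pair_bigA _ (fun s t => F (center i (s, t)) (leaves i (s, t)))) /=.
rewrite (pair_bigA _ (fun i (f : bool * bool) =>
  F (center (i : 'I__) (f.1, f.2)) (leaves i (f.1, f.2)))) /=.
pose g (p : 'I_(M./2 - 3) * (bool * bool)) := (center p.1 p.2, leaves p.1 p.2).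
have iM (i : 'I_(M./2 - 3)) : (i + 3 < M./2)%N by have := ltn_ord i; lia.
have g_inj : injective g.
  move=> [i f] [j f'] [cE lE].
  have [ij ->] := claw_center_inj (iM i) (iM j) cE lE.
  by congr (_, _); apply: val_inj.
rewrite pair_big_dep /= (eq_bigl (mem (g @: setT))) => [|[v K]] /=.
  rewrite big_imset => [|p q _ _ /g_inj] //=.
  by apply: eq_big => [p|[i [s t]] _] //; rewrite inE.
apply/and3P/imsetP => [[sK _ cK]|[[i f] _ [-> ->]]].
  have [i [f [iM' -> ->]]] := star_classify sK cK.
  have i3 : (i < M./2 - 3)%N by lia.
  by exists (Ordinal i3, f).
have cl := claw_center_leaf M_gt0 f (iM i).
rewrite (claw_card cl); split=> //; apply: claw_star cl.
  exact: adj_sym.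
exact: adj_irr.
Qed.

Variables (C : nzRingType) (A : algType C) (h : vert M -> A).
Hypothesis h_anti : forall u v, adj u v -> h u * h v = - (h v * h u).
Hypothesis h_comm : forall u v, u != v -> ~~ adj u v -> h u * h v = h v * h u.
Hypothesis h_rel : forall m : int, 2 <= m -> m <= (M./2)%:Z - 2 ->
  Aop h m * Cop h (m + 1) = Cop h m * Aop h (m + 2).

Lemma hgenE (j : int) n : (n < M)%N -> j = n.+1%:Z -> hgen h j = h (xv M_gt0 n).
Proof.
by move=> nM ->; rewrite /hgen /xv /insubd; case: insubP => //; rewrite nM.
Qed.

Lemma hbarE (j : int) n : (n <= M./2)%N -> j = (2 * n + 1)%N%:Z ->
  hbar h j = h (yv M n).
Proof.
move=> nM ->; rewrite /hbar /= addn1 /= mul2n odd_double uphalf_double /=.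
rewrite /yv /inord /insubd; case: insubP => //=; by rewrite ltnS nM.
Qed.

Definition claw_mon (i : nat) (f : bool * bool) : A :=
  h (center i f) * (h (leaf1 M_gt0 i f) * h (leaf2 M_gt0 i f) * h (leaf3 M_gt0 i f)).

Lemma claw_mon_sum i : (i + 3 < M./2)%N ->
  \sum_s \sum_t claw_mon i (s, t) = 0.
Proof.
move=> iM; have cl f := claw_center_leaf M_gt0 f iM.
have anti v a b c : claw (@adj M) v a b c ->
    [/\ h v * h a = - (h a * h v), h v * h b = - (h b * h v) & h b * h c = h c * h b].
  case/and3P=> /and3P[va vb _] /and3P[_ _ bc] /and3P[_ _ nbc].
  by split; [apply: h_anti | apply: h_anti | apply: h_comm].
have [cx_x0 cx_x3 _] := anti _ _ _ _ (cl (true, true)).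
have [cx_x1 cx_y2 _] := anti _ _ _ _ (cl (true, false)).
have [cy_x0 _ x4_x7] := anti _ _ _ _ (cl (false, true)).
have x0_x3 : h (xv M_gt0 (2 * i)) * h (xv M_gt0 (2 * i + 3)) =
             h (xv M_gt0 (2 * i + 3)) * h (xv M_gt0 (2 * i)).
  by case/and3P: (cl (true, true)) => _ /and3P[x03 _ _] /and3P[nx03 _ _]; apply: h_comm.
(* With m = i + 2, the 1-based $h_j$ becomes [xv (j - 1)] and $\bar h_{2p+1}$ becomes [yv p]. All
   indices are in range, the extreme ones being [2 * i + 7] and [i + 4]. *)
set m : int := i.+2%:Z; have /= := @h_rel m; rewrite /Aop /Cop.
rewrite (@hgenE (2 * m) (2 * i + 3)); try lia.
rewrite (@hgenE (2 * m - 3) (2 * i)); try lia.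
rewrite (@hgenE (2 * m - 2) (2 * i + 1)); try lia.
rewrite (@hgenE (2 * (m + 1) - 3) (2 * i + 2)); try lia.
rewrite (@hgenE (2 * (m + 2)) (2 * i + 7)); try lia.
rewrite (@hgenE (2 * (m + 2) - 3) (2 * i + 4)); try lia.
rewrite (@hgenE (2 * (m + 2) - 2) (2 * i + 5)); try lia.
rewrite (@hbarE (2 * m + 1) (i + 2)); try lia.
rewrite (@hbarE (2 * (m + 1) + 3) (i + 4)); try lia.
rewrite (@hbarE (2 * m + 3) (i + 3)); try lia.
rewrite (@hbarE (2 * (m + 2) + 1) (i + 4)); try lia.
have m2 : 2 <= m by lia.
have mM : m <= (M./2)%:Z - 2 by lia.
move=> /(_ m2 mM) rel; rewrite !big_bool /claw_mon.
move: cx_x0 cx_x3 cx_x1 cx_y2 cy_x0 x4_x7 x0_x3 rel.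
rewrite /claw_center /leaf1 /leaf2 /leaf3 /=.
move: (h (xv _ (2 * i))) (h (xv _ (2 * i + 1))) (h (xv _ (2 * i + 2)))
  (h (xv _ (2 * i + 3))) (h (xv _ (2 * i + 4))) (h (xv _ (2 * i + 5)))
  (h (xv _ (2 * i + 7))) (h (yv _ (i + 2))) (h (yv _ (i + 3))) (h (yv _ (i + 4))).
move=> x0 x1 cx x3 x4 x5 x7 y2 cy y4 cx_x0 cx_x3 cx_x1 cx_y2 cy_x0 x4_x7 x0_x3 rel.
(* The centre [cx] passes two leaves, so the signs cancel and the two monomials form
   $A_{2m-1}C_{2m+2}$. *)
have -> : cx * (x0 * x3 * y4) = x3 * x0 * (cx * y4).
  by rewrite x0_x3 !mulrA cx_x3 !mulNr -(mulrA x3 cx) cx_x0 mulrN mulNr opprK !mulrA.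
have -> : cx * (x1 * y2 * y4) = x1 * y2 * (cx * y4).
  by rewrite !mulrA cx_x1 !mulNr -(mulrA x1 cx) cx_y2 mulrN mulNr opprK !mulrA.
(* The centre [cy] passes only [x0]; the single sign yields $-C_{2m}A_{2m+3}$. *)
rewrite -!(mulrA x0) !(mulrA cy) cy_x0 x4_x7 -mulrDl rel -mulrDr.
by rewrite mulNr subrr.
Qed.

(** By [claw_outside] the second factor is free of [f], so it can be pulled out of the sum over a
    quadruple. *)
Lemma star_term_claw k i f : (i + 3 < M./2)%N ->
  star_term (@adj M) h k (center i f) (leaves i f) =
  claw_mon i f * \sum_(T | [&& stable (@adj M) T, (3 + #|T|)%N == k
    & [forall w in T, outside i w]]) hprod h T.
Proof.
move=> iM; have cl := claw_center_leaf M_gt0 f iM.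
rewrite /star_term (claw_hprod (@adj_sym M) h_comm cl) (claw_card cl); congr (_ * _).
apply: eq_bigl => T; congr [&& _, _ & _].
apply/detachedP/forall_inP => [d w wT|d u w uL wT].
  rewrite -(claw_outside M_gt0 f) //; apply/forall_inP => u uL.
  by apply/andP; apply: d.
have := d w wT; rewrite -(claw_outside M_gt0 f) // => /forall_inP/(_ u uL).
by case/andP.
Qed.
End ClawSum.

(** * Vanishing of the commutator for the charges of the frustration graph *)

Theorem theorem1 (R : realType) (A : algType R[i]) (M : nat) (hM : (1 <= M)%N)
  (h : vert M -> A) (b : vert M -> R[i])
  (hsq : forall v, h v ^+ 2 = (b v ^+ 2)%:A)
  (hanti : forall u v, adj u v -> h u * h v = - (h v * h u))
  (hcomm : forall u v, u != v -> ~~ adj u v -> h u * h v = h v * h u)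
  (hrel : forall m : int, 2 <= m -> m <= (M./2)%:Z - 2 ->
     Aop h m * Cop h (m + 1) = Cop h m * Aop h (m + 2))
  (k : nat) :
  H h * Q h k - Q h k * H h = 0.
Proof.
transitivity ((\sum_v \sum_(K | [&& star (@adj M) v K, odd #|K| & (2 < #|K|)%N])
  star_term (@adj M) h k v K) *+ 2).
  (* [H], [Q] and [independent] agree by conversion with the sums and [stable] of the general graph
     setting. *)
  exact: (commutator_claws (@adj_sym M) (@adj_irr M) hanti hcomm).
rewrite (claw_sum hM) big1 ?mul0rn // => i _.
have iM : (i + 3 < M./2)%N by have := ltn_ord i; lia.
under eq_bigr => s _ do under eq_bigr => t _ do
  rewrite (star_term_claw hM hcomm) //.
under eq_bigr => s _ do rewrite -mulr_suml.
by rewrite -mulr_suml (claw_mon_sum hM hanti hcomm hrel) // mul0r.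
Qed.
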